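(* Let $S$ be a Hausdorff topological semigroup. Then $S$ is a topological paragroup if and only if all of the following hold: $S$ is simple; $S$ contains an idempotent; $S$ contains no (algebraically) isomorphic copy of the bicyclic semigroup; and, for each idempotent $e$ of $S$, the maximal subgroup $H_e$ of $S$ containing $e$, with the subspace topology, is a topological group.
   Context: All topological spaces are Hausdorff and all semigroups are nonempty. A topological semigroup is a topological space with a jointly continuous associative binary operation. A semigroup $S$ is simple if it contains no proper (nonempty) two-sided ideal. The bicyclic semigroup $\mathcal C(p,q)$ is the semigroup with two-sided unit $1$ generated by two elements $p,q$ subject to the single relation $qp=1$. For an idempotent $e$, $H_e$ denotes the maximal subgroup of $S$ containing $e$ (the largest subsemigroup of $S$ that is a group with identity $e$). For a group $H$, sets $X,Y$ and a map $\sigma:Y\times X\to H$, the Rees product $[X,H,Y]_\sigma$ is the set $X\times H\times Y$ with the operation $(x,h,y)\cdot(x',h',y')=(x,h\,\sigma(y,x')\,h',y')$. A topological paragroup is a topological semigroup that is topologically isomorphic (isomorphic via a homeomorphism) to a Rees product $[X,H,Y]_\sigma$ with the product topology, where $X,Y$ are topological spaces, $H$ is a topological group (multiplication and inversion continuous) and $\sigma:Y\times X\to H$ is continuous. *)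

(* Defs.v *)
From HB Require Import structures.
From mathcomp Require Import all_boot.
From mathcomp Require Import boolp classical_sets functions topology.

Set Implicit Arguments.
Unset Strict Implicit.
Unset Printing Implicit Defensive.

Local Open Scope classical_set_scope.
Local Open Scope quotient_scope.
Local Open Scope group_scope.

HB.structure Definition PreTopologicalSemigroup :=
  {S of Semigroup S & Topological S}.

HB.mixin Record isTopologicalSemigroup S of Semigroup S & Topological S := {
  mulg_continuous : continuous (fun z : S * S => z.1 * z.2)
}.

#[short(type="topologicalSemigroupType")]
HB.structure Definition TopologicalSemigroup :=
  {S of Semigroup S & Topological S & isTopologicalSemigroup S}.

(* A group carrying a topology, with no compatibility required. *)
#[short(type="preTopologicalGroupType")]
HB.structure Definition PreTopologicalGroup := {G of Group G & Topological G}.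

Definition topological_group (G : preTopologicalGroupType) : Prop :=
  continuous (fun z : G * G => z.1 * z.2) /\ continuous (fun x : G => x^-1).

Section SemigroupNotions.
Variable S : semigroupType.

Definition is_idempotent (e : S) : Prop := e * e = e.

Definition two_sided_ideal (I : set S) : Prop :=
  I !=set0 /\ forall x s, I x -> I (s * x) /\ I (x * s).

Definition simple_semigroup : Prop :=
  forall I : set S, two_sided_ideal I -> I = [set: S].

(* [G] is a subsemigroup of [S] that is a group with identity [e]. *)
Definition subgroup_at (e : S) (G : set S) : Prop :=
  [/\ G e,
      forall x y, G x -> G y -> G (x * y),
      forall x, G x -> e * x = x /\ x * e = x
    & forall x, G x -> exists y, [/\ G y, y * x = e & x * y = e]].

(* The lemmas below show that this union is itself a subgroup at [e] when [e]
   is idempotent, hence the largest one. *)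
Definition max_subgroup (e : S) : set S :=
  \bigcup_(G in [set G | subgroup_at e G]) G.

Lemma max_subgroup_largest e (G : set S) :
  subgroup_at e G -> G `<=` max_subgroup e.
Proof. by move=> Ge x Gx; exists G. Qed.

Lemma max_subgroup_subgroup e :
  is_idempotent e -> subgroup_at e (max_subgroup e).
Proof.
move=> ee.
pose U : set S := [set x | [/\ e * x = x, x * e = x &
  exists y, [/\ e * y = y, y * e = y, y * x = e & x * y = e]]].
have UE : max_subgroup e `<=` U.
  move=> x [G [_ _ Gid Ginv] Gx]; have [ex xe] := Gid _ Gx.
  by have [y [/Gid[ey ye] yx xy]] := Ginv _ Gx; split => //; exists y.
have Usub : subgroup_at e U.
  split.
  - by split => //; exists e.
  - move=> x y [ex xe [x' [ex' x'e x'x xx']]] [ey ye [y' [ey' y'e y'y yy']]].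
    split; [by rewrite mulgA ex | by rewrite -mulgA ye |].
    exists (y' * x'); split.
    + by rewrite mulgA ey'.
    + by rewrite -mulgA x'e.
    + by rewrite -mulgA (mulgA x') x'x ey.
    + by rewrite -mulgA (mulgA y) yy' ex'.
  - by move=> x [].
  - move=> x [ex xe [y [ey ye yx xy]]].
    by exists y; split => //; split => //; exists x.
suff -> : max_subgroup e = U by [].
by apply/seteqP; split => //; exact: max_subgroup_largest.
Qed.

End SemigroupNotions.

(* The type of elements of the maximal subgroup; the proof that [e] is
   idempotent is a parameter so that the group structure can be inferred. *)
Definition maxgroup (S : semigroupType) (e : S) (ee : is_idempotent e) : Type :=
  set_type (max_subgroup e).

Section MaxGroup.
Variables (S : semigroupType) (e : S) (ee : is_idempotent e).
Local Notation H := (maxgroup ee).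

HB.instance Definition _ := Choice.copy H (set_type (max_subgroup e)).

Let Hsub : subgroup_at e (max_subgroup e) := max_subgroup_subgroup ee.

Let maxgroup_set (x : H) : max_subgroup e (set_val x).
Proof. exact: set_mem (valP x). Qed.

Let maxgroup_mul_subproof (x y : H) :
  set_val x * set_val y \in max_subgroup e.
Proof. by case: Hsub => _ HM _ _; apply/mem_set/HM; exact: maxgroup_set. Qed.

Definition maxgroup_mul (x y : H) : H := 
  exist (fun z => z \in max_subgroup e) _ (maxgroup_mul_subproof x y).

Let maxgroup_one_subproof : e \in max_subgroup e.
Proof. by case: Hsub => He _ _ _; apply/mem_set. Qed.

Definition maxgroup_one : H := 
  exist (fun z => z \in max_subgroup e) e maxgroup_one_subproof.

Let maxgroup_inv_subproof (x : H) :
  exists y : H, maxgroup_mul y x = maxgroup_one /\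
                maxgroup_mul x y = maxgroup_one.
Proof.
case: Hsub => _ _ _ /(_ _ (maxgroup_set x)) [y [Hy yx xy]].
by exists (exist (fun z => z \in max_subgroup e) y (mem_set Hy)); split; apply: val_inj.
Qed.

Definition maxgroup_inv (x : H) : H := sval (cid (maxgroup_inv_subproof x)).

Let maxgroup_mulA : associative maxgroup_mul.
Proof. by move=> x y z; apply: val_inj; exact: mulgA. Qed.

Let maxgroup_mul1 : left_id maxgroup_one maxgroup_mul.
Proof.
by move=> x; apply: val_inj; case: Hsub => _ _ /(_ _ (maxgroup_set x))[].
Qed.

Let maxgroup_mulr1 : right_id maxgroup_one maxgroup_mul.
Proof.
by move=> x; apply: val_inj; case: Hsub => _ _ /(_ _ (maxgroup_set x))[].
Qed.

Let maxgroup_mulV : left_inverse maxgroup_one maxgroup_inv maxgroup_mul.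
Proof. by move=> x; rewrite /maxgroup_inv; case: cid => y []. Qed.

Let maxgroup_mulrV : right_inverse maxgroup_one maxgroup_inv maxgroup_mul.
Proof. by move=> x; rewrite /maxgroup_inv; case: cid => y []. Qed.

HB.instance Definition _ := isGroup.Build H
  maxgroup_mulA maxgroup_mul1 maxgroup_mulr1 maxgroup_mulV maxgroup_mulrV.

End MaxGroup.

(* [set_type] carries the subspace topology. *)
HB.instance Definition _ (S : topologicalSemigroupType) (e : S)
    (ee : is_idempotent e) :=
  Topological.copy (maxgroup ee) (set_type (max_subgroup e)).

(* Words in the generators [true] and [false], read as p and q respectively,
   modulo the least congruence identifying qp with the empty word. *)
Inductive bicyclic_cong : seq bool -> seq bool -> Prop :=
| bicyclic_cong_qp : bicyclic_cong [:: false; true] [::]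
| bicyclic_cong_refl u : bicyclic_cong u u
| bicyclic_cong_sym u v : bicyclic_cong u v -> bicyclic_cong v u
| bicyclic_cong_trans v u w :
    bicyclic_cong u v -> bicyclic_cong v w -> bicyclic_cong u w
| bicyclic_cong_cat u u' v v' :
    bicyclic_cong u u' -> bicyclic_cong v v' ->
    bicyclic_cong (u ++ v) (u' ++ v').

Definition bicyclic_rel (u v : seq bool) : bool := `[< bicyclic_cong u v >].

Lemma bicyclic_rel_refl : reflexive bicyclic_rel.
Proof. by move=> u; apply/asboolP/bicyclic_cong_refl. Qed.

Lemma bicyclic_rel_sym : symmetric bicyclic_rel.
Proof. by move=> u v; apply/asboolP/asboolP; exact: bicyclic_cong_sym. Qed.

Lemma bicyclic_rel_trans : transitive bicyclic_rel.
Proof.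
move=> v u w /asboolP uv /asboolP vw.
by apply/asboolP; exact: bicyclic_cong_trans vw.
Qed.

Canonical bicyclic_equiv :=
  EquivRel bicyclic_rel bicyclic_rel_refl bicyclic_rel_sym bicyclic_rel_trans.

Definition bicyclic : Type := {eq_quot bicyclic_equiv}.

HB.instance Definition _ := Choice.copy bicyclic {eq_quot bicyclic_equiv}.

Definition bicyclic_class (u : seq bool) : bicyclic :=
  \pi_({eq_quot bicyclic_equiv}) u.

Definition bicyclic_one : bicyclic := bicyclic_class [::].
Definition bicyclic_mul (x y : bicyclic) : bicyclic :=
  bicyclic_class (repr (x : {eq_quot bicyclic_equiv}) ++
                  repr (y : {eq_quot bicyclic_equiv})).

Lemma bicyclic_classP u v :
  bicyclic_class u = bicyclic_class v <-> bicyclic_cong u v.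
Proof.
split=> [/eqmodP/asboolP //|uv].
by apply/eqmodP/asboolP.
Qed.

Lemma bicyclic_class_surj x : exists u, x = bicyclic_class u.
Proof.
by exists (repr (x : {eq_quot bicyclic_equiv})); rewrite /bicyclic_class reprK.
Qed.

Lemma bicyclic_mul_class u v :
  bicyclic_mul (bicyclic_class u) (bicyclic_class v) = bicyclic_class (u ++ v).
Proof.
by apply/bicyclic_classP/bicyclic_cong_cat; apply/bicyclic_classP;
   rewrite /bicyclic_class reprK.
Qed.

Lemma bicyclic_mulA : associative bicyclic_mul.
Proof.
move=> x y z; have [u ->] := bicyclic_class_surj x.
have [v ->] := bicyclic_class_surj y; have [w ->] := bicyclic_class_surj z.
by rewrite !bicyclic_mul_class catA.
Qed.

Lemma bicyclic_mul1 : left_id bicyclic_one bicyclic_mul.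
Proof.
by move=> x; have [u ->] := bicyclic_class_surj x; rewrite bicyclic_mul_class.
Qed.

Lemma bicyclic_mulr1 : right_id bicyclic_one bicyclic_mul.
Proof.
move=> x; have [u ->] := bicyclic_class_surj x.
by rewrite bicyclic_mul_class cats0.
Qed.

HB.instance Definition _ :=
  isMonoid.Build bicyclic bicyclic_mulA bicyclic_mul1 bicyclic_mulr1.

(* Semigroup embeddings only: the unit need not be preserved ([S] has none). *)
Definition contains_bicyclic (S : semigroupType) : Prop :=
  exists f : bicyclic -> S, injective f /\ {morph f : x y / x * y}.

Definition rees_product (X : Type) (H : Type) (Y : Type)
  (sigma : Y * X -> H) : Type := (X * H * Y)%type.

Section ReesProduct.
Variables (X Y : choiceType) (H : groupType) (sigma : Y * X -> H).
Local Notation R := (rees_product sigma).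

HB.instance Definition _ := Choice.copy R (X * H * Y)%type.

Definition rees_mul (a b : R) : R :=
  let: (x, h, y) := a in let: (x', h', y') := b in
  (x, h * sigma (y, x') * h', y').

Lemma rees_mulA : associative rees_mul.
Proof. by move=> [[x h] y] [[x' h'] y'] [[x'' h''] y'']; rewrite /= !mulgA. Qed.

HB.instance Definition _ := isSemigroup.Build R rees_mulA.

End ReesProduct.

HB.instance Definition _ (X Y : topologicalType) (H : preTopologicalGroupType)
    (sigma : Y * X -> H) :=
  Topological.copy (rees_product sigma) (X * H * Y)%type.

Definition topological_paragroup (S : topologicalSemigroupType) : Prop :=
  exists (X Y : topologicalType) (H : preTopologicalGroupType)
    (sigma : Y * X -> H),
    [/\ [/\ hausdorff_space X, hausdorff_space Y & hausdorff_space H],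
        topological_group H,
        continuous sigma
      & exists (f : S -> rees_product sigma) (g : rees_product sigma -> S),
          [/\ cancel f g, cancel g f, continuous f, continuous g
            & {morph f : x y / x * y}]].

(* Main.v *)
(** If [q * p = e] but [p * q <> e] in some [eSe], then [p] and [q] generate a
    bicyclic semigroup: a coincidence between normal forms [p^i q^j] would give
    [p] a right inverse or [q] a left inverse.  So when [S] is simple without a
    bicyclic subsemigroup, one-sided inverses in [eSe] are two-sided, and
    [S a S = S] then makes [eSe] a group and puts [s] in [s e S].  The Rees
    coordinates of [s] are then [(s e (ese)^-1, ese, (ese)^-1 e s)], and
    continuity of inversion on [H_e = eSe] makes them continuous. *)
Require Import Defs.
From mathcomp Require Import all_boot.
From mathcomp Require Import boolp classical_sets functions topology.

Set Implicit Arguments.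
Unset Strict Implicit.
Unset Printing Implicit Defensive.

Local Open Scope classical_set_scope.

Definition to_set_type {T : Type} (A : set T) (x : T) (Ax : A x) : set_type A :=
  exist (fun z => z \in A) x (mem_set Ax).

(** * Continuity for products and subspaces; inheritance of the Hausdorff property *)

Section GeneralTopology.

Lemma continuous_pair {T U V : topologicalType} (f : T -> U) (g : T -> V) :
  continuous f -> continuous g -> continuous (fun t => (f t, g t)).
Proof. by move=> cf cg t; apply: cvg_pair; [exact: cf | exact: cg]. Qed.

Lemma continuous_compT {T U V : topologicalType} (f : T -> U) (g : U -> V) :
  continuous f -> continuous g -> continuous (g \o f).
Proof. by move=> cf cg t; apply: continuous_comp; [exact: cf | exact: cg]. Qed.

Lemma continuous_fst {T U : topologicalType} : continuous (@fst T U).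
Proof. by move=> x; exact: cvg_fst. Qed.

Lemma continuous_snd {T U : topologicalType} : continuous (@snd T U).
Proof. by move=> x; exact: cvg_snd. Qed.

Lemma set_val_continuous {T : topologicalType} (A : set T) :
  continuous (set_val : A -> T).
Proof. exact: initial_continuous. Qed.

Lemma continuous_set_type {T U : topologicalType} (A : set U) (f : T -> A) :
  continuous (set_val \o f) -> continuous f.
Proof. exact: continuous_comp_initial. Qed.

Lemma inj_continuous_hausdorff {T U : topologicalType} (f : T -> U) :
  injective f -> continuous f -> hausdorff_space U -> hausdorff_space T.
Proof.
move=> finj fc hU p q clpq; apply/finj/hU => A B nA nB.
by have [t [At Bt]] := clpq _ _ (fc _ _ nA) (fc _ _ nB); exists (f t).
Qed.

Lemma set_type_hausdorff {T : topologicalType} (A : set T) :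
  hausdorff_space T -> hausdorff_space (set_type A).
Proof.
by apply: inj_continuous_hausdorff (@set_val_continuous _ A); exact: val_inj.
Qed.

End GeneralTopology.

Section Semigroups.
Local Open Scope group_scope.

(** * Normal forms in the bicyclic semigroup and its embedding into [S] *)

Section Bicyclic.
Local Open Scope quotient_scope.

(** Induction on the word: a new leading [p] extends the [p]-block; a new leading [q] cancels the
    first [p] or, if there is none, joins the [q]-block. *)
Lemma bicyclic_normal_form (w : seq bool) :
  exists i j, bicyclic_cong w (nseq i true ++ nseq j false).
Proof.
elim: w => [|b w [i [j wij]]]; first by exists 0, 0; exact: bicyclic_cong_refl.
have bwij : bicyclic_cong (b :: w) (b :: nseq i true ++ nseq j false).
  by apply: (@bicyclic_cong_cat [:: b] [:: b]) => //; exact: bicyclic_cong_refl.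
case: b i bwij {wij} => [i|[|i]] bwij; first by exists i.+1, j.
  by exists 0, j.+1.
exists i, j; apply: bicyclic_cong_trans bwij _.
apply: (@bicyclic_cong_cat [:: false; true] [::]).
  exact: bicyclic_cong_qp.
exact: bicyclic_cong_refl.
Qed.

(* The bicyclic semigroup acts on [nat] by successor (p) and predecessor (q). *)
Lemma bicyclic_pq_neq1 :
  bicyclic_class [:: true; false] != bicyclic_class [::].
Proof.
pose act := foldr (fun b : bool => if b then S else predn).
have actP u v : bicyclic_cong u v -> act ^~ u =1 act ^~ v.
  elim=> {u v} //.
  - by move=> u v _ uv n; rewrite uv.
  - by move=> u v w _ uv _ vw n; rewrite uv vw.
  - move=> u u' v v' _ uu' _ vv' n.
    by rewrite /act !foldr_cat -!/(act _ _) vv' uu'.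
by apply/eqP => /bicyclic_classP/actP/(_ 0).
Qed.

Variables (S : semigroupType) (e p q : S).
Hypotheses (ee : e * e = e) (ep : e * p = p) (pe : p * e = p).
Hypotheses (eq : e * q = q) (qe : q * e = q) (qp : q * p = e).
Hypothesis pq : p * q <> e.

Let eval : seq bool -> S := foldr (fun b s => (if b then p else q) * s) e.

Let e_eval w : e * eval w = eval w.
Proof. by case: w => [|[] w] //=; rewrite mulgA ?ep ?eq. Qed.

Let eval_e w : eval w * e = eval w.
Proof. by elim: w => [|b w IH] //=; rewrite -mulgA IH. Qed.

Let eval_cat u v : eval (u ++ v) = eval u * eval v.
Proof. by elim: u => [|b u IH] /=; rewrite ?e_eval // IH mulgA. Qed.

Let eval_cong u v : bicyclic_cong u v -> eval u = eval v.
Proof.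
elim=> {u v} //=.
- by rewrite mulgA qp ee.
- by move=> u v w _ -> _ ->.
- by move=> u u' v v' _ uu' _ vv'; rewrite !eval_cat uu' vv'.
Qed.

(** From [p z = e] follows [q = q e = q p z = e z = z], hence [p q = e], against [pq]. *)
Let p_no_right_inverse z : e * z = z -> p * z <> e.
Proof.
move=> ez pz; apply: pq; suff -> : q = z by [].
by rewrite -[LHS]qe -pz mulgA qp ez.
Qed.

Let q_no_left_inverse z : z * e = z -> z * q <> e.
Proof.
move=> ze zq; apply: pq; suff -> : p = z by [].
by rewrite -[LHS]ep -zq -mulgA qp ze.
Qed.

Let eval_qp j : eval (nseq j false) * eval (nseq j true) = e.
Proof.
elim: j => [//|j IH]; rewrite -[in X in X * _]addn1 nseqD eval_cat /= qe.
by rewrite -mulgA (mulgA q) qp e_eval.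
Qed.

(** Cancelling [q^j] by [p^j] on the right would leave [e = q^m q], a left inverse of [q]. *)
Let eval_q_neq j m :
  eval (nseq j false) <> eval (nseq m false) * q * eval (nseq j false).
Proof.
move=> /(congr1 ( *%g^~ (eval (nseq j true)))).
rewrite -!mulgA eval_qp qe => emq.
by apply: (@q_no_left_inverse (eval (nseq m false))).
Qed.

Let eval_q_inj j l : eval (nseq j false) = eval (nseq l false) -> j = l.
Proof.
have lt j' l' : (j' < l')%N -> eval (nseq j' false) <> eval (nseq l' false).
  (* Splits [q^l'] as [q^m q q^j'] with [m = l' - j' - 1]. *)
  move=> /subnK <-; rewrite -addSnnS -addn1 -addnA !nseqD !eval_cat /= qe mulgA.
  exact: eval_q_neq.
by move=> jl; case: (ltngtP j l) => // /lt; rewrite jl.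
Qed.

(** Multiplying by [p^j] on the right would give [p] a right inverse. *)
Let eval_q_neq_p j w : eval (nseq j false) <> p * eval w.
Proof.
move=> /(congr1 ( *%g^~ (eval (nseq j true)))).
rewrite eval_qp -mulgA -eval_cat => /esym.
exact: p_no_right_inverse.
Qed.

(** Left multiplication by [q] strips one [p] from both sides; once a side has no [p] left,
    [eval_q_neq_p] and [eval_q_inj] decide. *)
Let eval_normal_inj i j k l :
  eval (nseq i true ++ nseq j false) = eval (nseq k true ++ nseq l false) ->
  i = k /\ j = l.
Proof.
elim: i k => [|i IH] [|k] /=.
- by move=> /eval_q_inj.
- by move=> /eval_q_neq_p.
- by move=> /esym/eval_q_neq_p.
- by move=> /(congr1 ( *%g q)); rewrite !mulgA qp !e_eval => /IH[-> ->].
Qed.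

(** Evaluation descends to classes by [eval_cong]; it is injective because every class contains a
    normal form and normal forms are separated by their values. *)
Lemma contains_bicyclic_of_left_inverse : contains_bicyclic S.
Proof.
pose f (x : bicyclic) : S := eval (repr (x : {eq_quot bicyclic_equiv})).
have f_class u : f (bicyclic_class u) = eval u.
  by apply/eval_cong/bicyclic_classP; rewrite /bicyclic_class reprK.
exists f; split=> x y.
  have [u ->] := bicyclic_class_surj x; have [v ->] := bicyclic_class_surj y.
  rewrite !f_class; have [i [j uij]] := bicyclic_normal_form u.
  have [k [l vkl]] := bicyclic_normal_form v.
  rewrite (eval_cong uij) (eval_cong vkl) => /eval_normal_inj[ik jl].
  apply/bicyclic_classP; apply: bicyclic_cong_trans uij _; rewrite ik jl.
  exact: bicyclic_cong_sym.
have [u ->] := bicyclic_class_surj x; have [v ->] := bicyclic_class_surj y.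
by rewrite [_ * _]bicyclic_mul_class !f_class eval_cat.
Qed.

End Bicyclic.

(** * The local submonoid [eSe] of a simple semigroup without bicyclic copies *)

Section Andersen.
Variables (S : semigroupType) (e : S).
Hypotheses (Ssimple : simple_semigroup S) (Sbicyclic : ~ contains_bicyclic S).
Hypothesis ee : is_idempotent e.

(** [S a S] is an ideal, so simplicity makes it all of [S]. *)
Lemma simple_semigroup_factor (a s : S) : exists u v, s = u * a * v.
Proof.
suff : [set t | exists u v, t = u * a * v] s by [].
rewrite (Ssimple (I := [set t | exists u v, t = u * a * v])) //; split.
  by exists (a * a * a), a, a.
move=> _ t [u [v ->]]; split; first by exists (t * u), v; rewrite !mulgA.
by exists u, (v * t); rewrite !mulgA.
Qed.

Lemma local_left_inverse_right (p q : S) :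
  e * p = p -> p * e = p -> e * q = q -> q * e = q -> q * p = e -> p * q = e.
Proof.
move=> ep pe eq qe qp; apply: contrapT => pq; apply: Sbicyclic.
exact: (@contains_bicyclic_of_left_inverse _ e p q).
Qed.

(** Simplicity gives [u a v = e] with [u], [v] in [eSe]. Reversing [(u a) v = e] and [u (a v) = e]
    yields [v u a = e] and [a v u = e]. *)
Lemma local_submonoid_group (a : S) : e * a = a -> a * e = a ->
  exists b, [/\ e * b = b, b * e = b, b * a = e & a * b = e].
Proof.
move=> ea ae; have [u' [v']] := simple_semigroup_factor a e.
(* Cutting the factors down to [eSe] keeps the factorization of [e], since [a = e a e]. *)
pose u := e * u' * e; pose v := e * v' * e => uav'.
have eu : e * u = u by rewrite /u !mulgA ee.
have ue : u * e = u by rewrite /u -!mulgA ee.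
have ev : e * v = v by rewrite /v !mulgA ee.
have ve : v * e = v by rewrite /v -!mulgA ee.
have uav : u * a * v = e.
  rewrite /u /v -!mulgA (mulgA e a) ea (mulgA a e) ae.
  by rewrite (mulgA a) (mulgA u') (mulgA u') -uav' ee ee.
exists (v * u); split.
- by rewrite mulgA ev.
- by rewrite -mulgA ue.
- rewrite -mulgA; apply: local_left_inverse_right => //.
  + by rewrite mulgA eu.
  + by rewrite -mulgA ae.
- rewrite mulgA; apply: local_left_inverse_right => //.
  + by rewrite mulgA ea.
  + by rewrite -mulgA ve.
  + by rewrite mulgA.
Qed.

(** All of [eSe] is a group by [local_submonoid_group], so [H_e = eSe]. *)
Lemma max_subgroupP (a : S) : max_subgroup e a <-> e * a = a /\ a * e = a.
Proof.
split=> [[G [_ _ Gid _] /Gid//]|[ea ae]].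
apply: (@max_subgroup_largest _ e [set x | e * x = x /\ x * e = x]) => //.
split=> //.
- move=> x y [ex xe] [ey ye]; split; first by rewrite mulgA ex.
  by rewrite -mulgA ye.
- by move=> x [/local_submonoid_group h /h[b [? ? ? ?]]]; exists b.
Qed.

(** With [s = u e v] and [w] inverse to [e v e] in [eSe], [s e w v = u (e v e w) v = u e v = s]. *)
Lemma mem_right_ideal (s : S) : exists t, s = s * e * t.
Proof.
have [u [v suv]] := simple_semigroup_factor e s.
have [||w [ew we _ vw]] := @local_submonoid_group (e * v * e).
- by rewrite !mulgA ee.
- by rewrite -!mulgA ee.
exists (w * v); rewrite {2}suv.
transitivity (u * (e * v * e * w) * v); first by rewrite vw.
by rewrite !mulgA.
Qed.

End Andersen.

(** * Algebra of Rees products: factorization, one-sided inverses, inversion formula *)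

Section ReesProductAlgebra.
Variables (X Y : choiceType) (H : groupType) (sigma : Y * X -> H).
Local Notation R := (rees_product sigma).

Lemma rees_mulE (x x' : X) (h h' : H) (y y' : Y) :
  ((x, h, y) : R) * ((x', h', y') : R) = (x, h * sigma (y, x') * h', y').
Proof. by []. Qed.

Lemma rees_idempotent (x : X) (y : Y) :
  is_idempotent ((x, (sigma (y, x))^-1, y) : R).
Proof. by rewrite /is_idempotent rees_mulE mulVg mul1g. Qed.

(** Yields simplicity of Rees products. The outer coordinates come from [s]; the group entries of
    [u] and [v] cancel [h] and both sandwich factors. *)
Lemma rees_factor (a s : R) : exists u v, s = u * a * v.
Proof.
case: a s => [[x h] y] [[x' h'] y'].
exists (x', h' * h^-1 * (sigma (y', x))^-1, y').
exists (x, (sigma (y, x))^-1, y').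
by rewrite !rees_mulE !mulgVK mulgK.
Qed.

(** Being fixed by [e] puts [p] and [q] into the block [{x} * H * {y}] of [e]. Left multiplication
    of the middle entry by [sigma (y, x)] identifies this block with the group [H]. This rules out
    bicyclic copies. *)
Lemma rees_left_inverse_right (e p q : R) :
  e * p = p -> p * e = p -> e * q = q -> q * e = q -> q * p = e -> p * q = e.
Proof.
case: e p q => [[x h] y] [[xp p] yp] [[xq q] yq]; rewrite !rees_mulE.
case=> <- hp [_ <-] [<- _] [_ <-] [qp].
congr (_, _, _).
have hs : h * sigma (y, x) = 1 by apply: (mulIg p); rewrite mul1g.
have sh : sigma (y, x) * h = 1 by rewrite -(mulg1_eq hs) mulVg.
apply: (mulgI (sigma (y, x))); rewrite sh.
have /mulg1_eq : sigma (y, x) * q * (sigma (y, x) * p) = 1.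
  by rewrite -sh -qp !mulgA.
by rewrite !mulgA -mulgA => <-; rewrite mulVg.
Qed.

(** In the block of [e] the middle entry of [e] is [h = sigma (y, x)^-1], so solving [a sigma b = h]
    gives [b = h a^-1 h], a formula continuous in [a] when [H] is a topological group. *)
Lemma rees_local_inverse (e a b : R) : is_idempotent e ->
  e * a = a -> a * e = a -> e * b = b -> b * e = b -> a * b = e ->
  b = (e.1.1, e.1.2 * a.1.2^-1 * e.1.2, e.2).
Proof.
case: e a b => [[x h] y] [[xa a] ya] [[xb b] yb] /=.
rewrite /is_idempotent !rees_mulE.
case=> hh [<- _] [_ <-] [<- _] [_ <-] [ab]; congr (_, _, _).
have hs : h * sigma (y, x) = 1 by apply: (mulIg h); rewrite mul1g.
have sh : sigma (y, x) * h = 1 by rewrite -(mulg1_eq hs) mulVg.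
by rewrite -{2}ab -(mulg1_eq sh) !mulgA mulgVK mulVg mul1g.
Qed.

End ReesProductAlgebra.

(** * Continuity of products in [S] and of maps into and out of [H_e] *)

Lemma continuous_mul {T : topologicalType} (S : topologicalSemigroupType)
    (f g : T -> S) :
  continuous f -> continuous g -> continuous (fun t => f t * g t).
Proof.
by move=> cf cg; exact: (continuous_compT (continuous_pair cf cg)) mulg_continuous.
Qed.

Lemma continuous_mull (S : topologicalSemigroupType) (a : S) :
  continuous (fun s : S => a * s).
Proof.
by apply: continuous_mul => [|t]; [exact: cst_continuous | exact: cvg_id].
Qed.

Lemma continuous_mulr (S : topologicalSemigroupType) (a : S) :
  continuous (fun s : S => s * a).
Proof.
apply: continuous_mul; last exact: cst_continuous.
by move=> t; exact: cvg_id.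
Qed.

Arguments continuous_mull {S} a.
Arguments continuous_mulr {S} a.

Lemma maxgroup_val_continuous (S : topologicalSemigroupType) (e : S)
    (ee : is_idempotent e) :
  continuous (set_val : maxgroup ee -> S).
Proof. exact: (@set_val_continuous S (max_subgroup e)). Qed.

Lemma continuous_maxgroup {T : topologicalType} (S : topologicalSemigroupType)
    (e : S) (ee : is_idempotent e) (f : T -> maxgroup ee) :
  continuous (set_val \o f : T -> S) -> continuous f.
Proof. exact: (@continuous_set_type T S (max_subgroup e)). Qed.

(** * Rees coordinates on a simple semigroup without bicyclic copies *)

Section ReesCoordinates.
Variables (S : topologicalSemigroupType) (e : S) (ee : is_idempotent e).
Hypotheses (Ssimple : simple_semigroup S) (Sbicyclic : ~ contains_bicyclic S).
Hypothesis He_topological : topological_group (maxgroup ee).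

Let H := maxgroup ee.
(** [X] and [Y] are the idempotents of [Se] and [eS]; for instance [x x = x e x = x e = x]. *)
Let X := set_type [set x : S | x * e = x /\ e * x = e].
Let Y := set_type [set y : S | e * y = y /\ y * e = e].

Let XP (x : X) : set_val x * e = set_val x /\ e * set_val x = e.
Proof. exact: set_mem (valP x). Qed.

Let YP (y : Y) : e * set_val y = set_val y /\ set_val y * e = e.
Proof. exact: set_mem (valP y). Qed.

Let HP (h : H) : e * set_val h = set_val h /\ set_val h * e = set_val h.
Proof. by apply/(max_subgroupP Ssimple Sbicyclic ee)/set_mem/(valP h). Qed.

Let val_mulVg (h : H) : set_val h^-1 * set_val h = e.
Proof. exact: (congr1 set_val (mulVg h)). Qed.

Let val_mulgV (h : H) : set_val h * set_val h^-1 = e.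
Proof. exact: (congr1 set_val (mulgV h)). Qed.

Let sigma_subproof (z : Y * X) :
  max_subgroup e (set_val z.1 * set_val z.2).
Proof.
apply/(max_subgroupP Ssimple Sbicyclic ee); split.
  by rewrite mulgA (YP _).1.
by rewrite -mulgA (XP _).1.
Qed.

(** The sandwich map is multiplication in [S], so [uncoord] is a morphism by associativity alone. *)
Let sigma (z : Y * X) : H :=
  to_set_type (sigma_subproof z).

Let local_subproof (s : S) : max_subgroup e (e * s * e).
Proof.
apply/(max_subgroupP Ssimple Sbicyclic ee).
by rewrite -!mulgA ee !mulgA ee.
Qed.

Let local (s : S) : H :=
  to_set_type (local_subproof s).

Let left_subproof (s : S) :
  [set x : S | x * e = x /\ e * x = e] (s * e * set_val (local s)^-1).
Proof.
split; first by rewrite -!mulgA (HP _).2.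
by rewrite !mulgA (val_mulgV (local s)).
Qed.

Let left (s : S) : X := to_set_type (left_subproof s).

Let right_subproof (s : S) :
  [set y : S | e * y = y /\ y * e = e] (set_val (local s)^-1 * e * s).
Proof.
split; first by rewrite !mulgA (HP _).1.
by rewrite -!mulgA (mulgA e) (val_mulVg (local s)).
Qed.

Let right (s : S) : Y := to_set_type (right_subproof s).

Let coord (s : S) : rees_product sigma := (left s, local s, right s).

Let uncoord (r : rees_product sigma) : S :=
  set_val r.1.1 * set_val r.1.2 * set_val r.2.

Let coordK : cancel coord uncoord.
Proof.
move=> s; have [t st] := mem_right_ideal Ssimple Sbicyclic ee s.
rewrite /uncoord /=; set k : S := set_val (local s)^-1.
have kh : k * (e * s * e) = e := val_mulVg (local s).
have ek : e * k = k := (HP _).1.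
transitivity (s * e * (k * (e * s * e)) * k * e * s); first by rewrite !mulgA.
(* The product has shrunk to [s e k e s]; writing the last [s] as [s e t] exposes [k (e s e) = e]
   once more. *)
rewrite kh -[s * e * e]mulgA ee -[s * e * k * e * s]mulgA {2}st.
transitivity (s * e * (k * (e * s * e)) * t); first by rewrite !mulgA.
by rewrite kh -[s * e * e]mulgA ee -st.
Qed.

Let local_uncoord r : local (uncoord r) = r.1.2.
Proof.
apply: val_inj; rewrite /= /uncoord !mulgA (XP _).2 -!mulgA (YP _).2.
by rewrite mulgA (HP _).1 (HP _).2.
Qed.

Let uncoordK : cancel uncoord coord.
Proof.
move=> [[x h] y]; rewrite /coord local_uncoord; congr (_, _, _).
  (* The left coordinate is [x h y e h^-1 = x h h^-1 = x e = x]. *)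
  apply: val_inj => /=; rewrite local_uncoord /uncoord /=.
  rewrite -!mulgA (mulgA _ e) (YP _).2 (mulgA (set_val h) e) (HP _).2.
  by rewrite val_mulgV (XP _).1.
apply: val_inj => /=; rewrite local_uncoord /uncoord /=.
rewrite !mulgA -(mulgA _ e) (XP _).2 -(mulgA _ e) (HP _).1.
by rewrite val_mulVg (YP _).1.
Qed.

Let uncoordM : {morph uncoord : r r' / r * r'}.
Proof.
move=> [[x h] y] [[x' h'] y'].
by rewrite /uncoord /= !mulgA.
Qed.

Let local_continuous : continuous local.
Proof.
apply: continuous_maxgroup.
exact: (continuous_compT (continuous_mull e) (continuous_mulr e)).
Qed.

Let local_inv_continuous : continuous (fun s => set_val (local s)^-1).
Proof.
apply: (continuous_compT (f := fun s => (local s)^-1)).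
  by apply: continuous_compT local_continuous _; exact: He_topological.2.
exact: set_val_continuous.
Qed.

Let sigma_continuous : continuous sigma.
Proof.
apply: continuous_maxgroup; apply: continuous_mul.
  by apply: continuous_compT continuous_fst _; exact: set_val_continuous.
by apply: continuous_compT continuous_snd _; exact: set_val_continuous.
Qed.

Let coord_continuous : continuous coord.
Proof.
apply: continuous_pair; first apply: continuous_pair => //.
- apply: continuous_set_type.
  exact: continuous_mul (continuous_mulr e) local_inv_continuous.
- apply: continuous_set_type; apply: continuous_mul; last first.
    by move=> t; exact: cvg_id.
  exact: continuous_compT local_inv_continuous (continuous_mulr e).
Qed.

Let uncoord_continuous : continuous uncoord.
Proof.
apply: continuous_mul; first apply: continuous_mul.
- apply: (continuous_compT (f := fun r : rees_product sigma => r.1.1)).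
    exact: continuous_compT continuous_fst continuous_fst.
  exact: set_val_continuous.
- apply: (continuous_compT (f := fun r : rees_product sigma => r.1.2)).
    exact: continuous_compT continuous_fst continuous_snd.
  exact: maxgroup_val_continuous.
- apply: (continuous_compT (f := fun r : rees_product sigma => r.2)).
    exact: continuous_snd.
  exact: set_val_continuous.
Qed.

Lemma simple_topological_paragroup :
  hausdorff_space S -> topological_paragroup S.
Proof.
move=> hS; exists X, Y, H, sigma; split => //.
- by split; exact: set_type_hausdorff.
- exists coord, uncoord; split => // s t.
  by apply: (can_inj uncoordK); rewrite uncoordM !coordK.
Qed.

End ReesCoordinates.

(** * The conditions satisfied by a topological paragroup *)

Lemma topological_paragroup_conditions (S : topologicalSemigroupType) :
  [set: S] !=set0 -> topological_paragroup S ->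
  [/\ simple_semigroup S,
      exists e : S, is_idempotent e,
      ~ contains_bicyclic S
    & forall (e : S) (ee : is_idempotent e), topological_group (maxgroup ee)].
Proof.
move=> [s0 _] [X [Y [H [sigma [_ [mulH invH] _]]]]].
move=> [f [g [fK gK fc gc fM]]].
have finj := can_inj fK.
split.
- move=> I [[a Ia] Iideal]; apply/seteqP; split => // s _.
  have [u [v fs]] := rees_factor (f a) (f s).
  have -> : s = g u * a * g v by apply: finj; rewrite !fM !gK.
  by apply: (Iideal _ _ _).2; apply: (Iideal _ _ _).1.
- case: (f s0) => [[x _] y].
  exists (g (x, (sigma (y, x))^-1, y)); apply: finj.
  by rewrite fM gK; exact: rees_idempotent.
(* In the Rees product the images of [P] and [Q] would satisfy [P Q = E] along with [Q P = E],
   contradicting [bicyclic_pq_neq1]. *)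
- move=> [phi [phi_inj phiM]].
  pose P := bicyclic_class [:: true]; pose Q := bicyclic_class [:: false].
  pose E := bicyclic_class [::].
  have QP : Q * P = E.
    rewrite [LHS]bicyclic_mul_class.
    by apply/bicyclic_classP; exact: bicyclic_cong_qp.
  have /eqP := bicyclic_pq_neq1; apply; apply/phi_inj/finj.
  have <- : P * Q = bicyclic_class [:: true; false] by exact: bicyclic_mul_class.
  rewrite phiM fM.
  by apply: rees_left_inverse_right; rewrite -fM -phiM ?QP //;
    congr (f (phi _)); rewrite [LHS]bicyclic_mul_class.
- move=> e ee; split.
    apply: continuous_maxgroup; apply: continuous_mul.
      exact: continuous_compT continuous_fst (@maxgroup_val_continuous _ _ ee).
    exact: continuous_compT continuous_snd (@maxgroup_val_continuous _ _ ee).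
  apply: continuous_maxgroup.
  pose x := (f e).1.1; pose h := (f e).1.2; pose y := (f e).2.
  (* [i] is the formula of [rees_local_inverse] extended to the whole Rees product; inversion on
     [H_e] is the restriction of [g \o i \o f]. *)
  pose i (r : rees_product sigma) : rees_product sigma :=
    (x, h * r.1.2^-1 * h, y).
  have mulHc (T : topologicalType) (a b : T -> H) :
      continuous a -> continuous b -> continuous (fun t => a t * b t).
    move=> ca cb; exact: (continuous_compT (continuous_pair ca cb)) mulH.
  have ic : continuous i.
    apply: continuous_pair; last exact: cst_continuous.
    apply: continuous_pair; first exact: cst_continuous.
    apply: (mulHc _ (fun r : rees_product sigma => h * r.1.2^-1)); last first.
      exact: cst_continuous.
    apply: (mulHc _ (fun=> h)); first exact: cst_continuous.
    apply: (continuous_compT (f := fun r : rees_product sigma => r.1.2)) => //.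
    exact: continuous_compT continuous_fst continuous_snd.
  have -> : set_val \o (fun k : maxgroup ee => k^-1) =
      g \o (i \o (f \o (set_val : maxgroup ee -> S))).
    apply/funext => k /=; apply: finj; rewrite gK.
    apply: rees_local_inverse; rewrite /is_idempotent -!fM; congr (f _).
    + exact: ee.
    + exact: (congr1 set_val (mul1g k)).
    + exact: (congr1 set_val (mulg1 k)).
    + exact: (congr1 set_val (mul1g k^-1)).
    + exact: (congr1 set_val (mulg1 k^-1)).
    + exact: (congr1 set_val (mulgV k)).
  apply: continuous_compT gc; apply: continuous_compT ic.
  apply: continuous_compT fc; exact: maxgroup_val_continuous.
Qed.

End Semigroups.

Theorem theorem3 (S : topologicalSemigroupType)
    (S_hausdorff : hausdorff_space S) (S_nonempty : [set: S] !=set0) :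
  topological_paragroup S <->
  [/\ simple_semigroup S,
      exists e : S, is_idempotent e,
      ~ contains_bicyclic S
    & forall (e : S) (ee : is_idempotent e), topological_group (maxgroup ee)].
Proof.
split; first exact: topological_paragroup_conditions.
move=> [Ssimple [e ee] Sbicyclic He].
exact: (simple_topological_paragroup Ssimple Sbicyclic (He e ee)).
Qed.
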